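(* For integers $n,k \ge 0$ let $J(n,k)$ be the number of independent sets of size $k$ in the $123$-core $U_n$, and let $F(x,y) = \sum_{n,k\ge 0} J(n,k)x^ny^k$. Then \[ F = 1 + xF + \frac{xyF^2}{1 - y(F-1)}, \] and for all $n \ge 1$, $k \ge 0$, \[ J(n,k) = \frac{1}{n}\sum_{j=0}^{n-1}\binom{n}{k-j}\binom{n}{j+1}\binom{n-1+j}{n-1}. \]
   Context: For $n \ge 0$, the $123$-core $U_n$ is the simple graph with vertex set $\{(i,j) : 1 \le i \le j \le n\}$, where $(i,j)$ and $(k,\ell)$ are adjacent if and only if either ($k < i$ and $j < \ell$) or ($i < k$ and $\ell < j$). ($U_0$ has no vertices.) An independent set is a set of pairwise non-adjacent vertices; the empty set counts as the unique independent set of size $0$. Binomial coefficients with lower index negative or exceeding the (nonnegative) upper index are $0$. *)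

(* Defs.v *)
From HB Require Import structures.
From mathcomp Require Import all_boot all_order all_algebra.
From mathcomp Require Import boolp.
Set Implicit Arguments.
Unset Strict Implicit.
Unset Printing Implicit Defensive.
Import Order.TTheory GRing.Theory Num.Theory.
Local Open Scope ring_scope.

Definition independent (T : finType) (e : rel T) (S : {set T}) : bool :=
  [forall u in S, forall v in S, ~~ e u v].

(* Coordinates live in 'I_n.+1 = {0, ..., n} so that they are the actual values
   1, ..., n. *)
Definition core_vertex (n : nat) : finType :=
  {p : 'I_n.+1 * 'I_n.+1 | (1 <= p.1 <= p.2)%N}.

Definition core_adj (n : nat) : rel (core_vertex n) := fun u v =>
  let: (i, j) := val u in let: (k, l) := val v in
  ((k < i) && (j < l) || (i < k) && (l < j))%N.

Lemma core_adj_sym n : symmetric (@core_adj n).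
Proof.
by case=> [[i j] ?] [[k l] ?]; rewrite /core_adj /= orbC.
Qed.

Lemma core_adj_irr n : irreflexive (@core_adj n).
Proof. by case=> [[i j] ?]; rewrite /core_adj /= !ltnn. Qed.

Definition J (n k : nat) : nat :=
  #|[set S : {set core_vertex n} | independent (@core_adj n) S & #|S| == k]|.

(* The lower index is an integer, because truncated subtraction on nat would
   turn the vanishing coefficients with k - j < 0 into 'C(n, 0) = 1. *)
Definition binz (n : nat) (z : int) : nat :=
  if z is Posz m then 'C(n, m) else 0%N.

(* Formal power series in one variable over R, f standing for
   \sum_i (coefs f i) X^i. The record keeps the Cauchy product apart from the
   pointwise ring structure on functions. *)
Record fps (R : Type) := Fps { coefs : nat -> R }.

Lemma fpsP (R : Type) (f g : fps R) : coefs f =1 coefs g -> f = g.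
Proof. by case: f g => [f] [g] /= /funext ->. Qed.

HB.instance Definition _ (R : Type) := gen_eqMixin (fps R).
HB.instance Definition _ (R : Type) := gen_choiceMixin (fps R).

Section FpsZmod.
Variable R : zmodType.
Implicit Types f g h : fps R.

Definition fps_zero : fps R := Fps (fun=> 0).
Definition fps_opp f : fps R := Fps (fun n => - coefs f n).
Definition fps_add f g : fps R := Fps (fun n => coefs f n + coefs g n).

Fact fps_addA : associative fps_add.
Proof. by move=> f g h; apply: fpsP => n /=; rewrite addrA. Qed.
Fact fps_addC : commutative fps_add.
Proof. by move=> f g; apply: fpsP => n /=; rewrite addrC. Qed.
Fact fps_add0 : left_id fps_zero fps_add.
Proof. by move=> f; apply: fpsP => n /=; rewrite add0r. Qed.
Fact fps_addN : left_inverse fps_zero fps_opp fps_add.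
Proof. by move=> f; apply: fpsP => n /=; rewrite addNr. Qed.

HB.instance Definition _ :=
  GRing.isZmodule.Build (fps R) fps_addA fps_addC fps_add0 fps_addN.
End FpsZmod.

Section FpsRing.
Variable R : comNzRingType.
Implicit Types f g h : fps R.

Definition fpsC (c : R) : fps R := Fps (fun n => if n == 0%N then c else 0).
Definition fpsX : fps R := Fps (fun n => (n == 1%N)%:R).
Definition fps_mul f g : fps R :=
  Fps (fun n => \sum_(i < n.+1) coefs f i * coefs g (n - i)).

Let trunc (m : nat) f : {poly R} := \poly_(i < m.+1) coefs f i.

Let coef_trunc m f n : (n <= m)%N -> (trunc m f)`_n = coefs f n.
Proof. by move=> le_nm; rewrite coef_poly ltnS le_nm. Qed.

Let mul_trunc m f g n :
  (n <= m)%N -> coefs (fps_mul f g) n = (trunc m f * trunc m g)`_n.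
Proof.
move=> le_nm; rewrite coefM /=; apply: eq_bigr => i _.
rewrite !coef_trunc //; first exact: leq_trans (leq_subr _ _) le_nm.
by apply: leq_trans le_nm; rewrite -ltnS.
Qed.

Let coefM_eq (p q p' q' : {poly R}) n :
  (forall i, (i <= n)%N -> p`_i = p'`_i) ->
  (forall i, (i <= n)%N -> q`_i = q'`_i) -> (p * q)`_n = (p' * q')`_n.
Proof.
move=> eqp eqq; rewrite !coefM; apply: eq_bigr => i _.
by rewrite eqp -1?ltnS // eqq // leq_subr.
Qed.

Fact fps_mulA : associative fps_mul.
Proof.
move=> f g h; apply: fpsP => n; rewrite !(mul_trunc _ _ (leqnn n)).
transitivity ((trunc n f * (trunc n g * trunc n h))`_n).
  by apply: coefM_eq => // i le_in; rewrite coef_trunc // (mul_trunc _ _ le_in).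
rewrite mulrA; apply: coefM_eq => // i le_in.
by rewrite coef_trunc // (mul_trunc _ _ le_in).
Qed.

Fact fps_mulC : commutative fps_mul.
Proof.
by move=> f g; apply: fpsP => n; rewrite !(mul_trunc _ _ (leqnn n)) mulrC.
Qed.

Fact fps_mul1 : left_id (fpsC 1) fps_mul.
Proof.
move=> f; apply: fpsP => n /=; rewrite big_ord_recl /= mul1r subn0 big1 ?addr0//.
by move=> i _; rewrite mul0r.
Qed.

Fact fps_mulDl : left_distributive fps_mul (@fps_add R).
Proof.
move=> f g h; apply: fpsP => n /=; rewrite -big_split /=.
by apply: eq_bigr => i _; rewrite mulrDl.
Qed.

Fact fps_1neq0 : fpsC 1 != 0 :> fps R.
Proof.
by apply/eqP => /(congr1 (fun f => coefs f 0)) /eqP; rewrite /= oner_eq0.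
Qed.

HB.instance Definition _ := GRing.Zmodule_isComNzRing.Build (fps R)
  fps_mulA fps_mulC fps_mul1 fps_mulDl fps_1neq0.

Lemma coefsM f g n :
  coefs (f * g) n = \sum_(i < n.+1) coefs f i * coefs g (n - i).
Proof. by []. Qed.

Lemma coefs1 n : coefs (1 : fps R) n = (n == 0%N)%:R.
Proof. by case: n. Qed.

End FpsRing.

Section FpsUnit.
Variable R : comUnitRingType.
Implicit Types f g h : fps R.

(* The first n coefficients g_0, ..., g_(n-1) of the inverse g of f, obtained
   by solving \sum_(i <= m) f_(m - i) * g_i = (m == 0) for g_m. *)
Fixpoint fps_inv_seq f (n : nat) : seq R :=
  if n is m.+1 then
    let s := fps_inv_seq f m in
    rcons s ((coefs f 0)^-1 *
             ((m == 0%N)%:R - \sum_(i < m) coefs f (m - i) * s`_i))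
  else [::].

Definition fps_unit : pred (fps R) := fun f => coefs f 0 \is a GRing.unit.

Definition fps_inv f : fps R :=
  if fps_unit f then Fps (fun n => (fps_inv_seq f n.+1)`_n) else f.

Let size_inv_seq f n : size (fps_inv_seq f n) = n.
Proof. by elim: n => //= n IHn; rewrite size_rcons IHn. Qed.

Let nth_inv_seq f n i :
  (i < n)%N -> (fps_inv_seq f n)`_i = (fps_inv_seq f i.+1)`_i.
Proof.
elim: n => // n IHn; rewrite ltnS leq_eqVlt => /predU1P[-> // | lt_in].
by rewrite [in LHS]/= nth_rcons size_inv_seq lt_in IHn.
Qed.

Fact fps_mulVr : {in fps_unit, left_inverse 1 fps_inv *%R}.
Proof.
move=> f Uf; apply: fpsP => n; rewrite coefsM coefs1 /fps_inv.
have -> : fps_unit f by [].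
rewrite big_ord_recr /= subnn nth_rcons size_inv_seq ltnn eqxx mulrC mulrA.
rewrite mulrV // mul1r addrC -[RHS]subr0 -addrA; congr (_ + _).
rewrite oppr0; apply/eqP; rewrite addrC subr_eq0; apply/eqP.
by apply: eq_bigr => i _; rewrite mulrC (nth_inv_seq _ (ltn_ord i)).
Qed.

Fact fps_unitP f g : g * f = 1 -> fps_unit f.
Proof.
move/(congr1 (fun h => coefs h 0)); rewrite coefsM big_ord1 coefs1 /= => fg1.
by apply/unitrPr; exists (coefs g 0); rewrite mulrC.
Qed.

Fact fps_inv_out : {in [predC fps_unit], fps_inv =1 id}.
Proof. by move=> f; rewrite inE /= /fps_inv => /negPf; rewrite /in_mem /= => ->. Qed.

HB.instance Definition _ := GRing.ComNzRing_hasMulInverse.Build (fps R)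
  fps_mulVr fps_unitP fps_inv_out.

Lemma fps_unitE f : (f \is a GRing.unit) = (coefs f 0 \is a GRing.unit).
Proof. by []. Qed.

End FpsUnit.

(* Q[[x, y]], realised as (Q[[y]])[[x]]. *)
Definition fps2 := fps (fps rat).
HB.instance Definition _ := GRing.ComUnitRing.on fps2.

Definition varx : fps2 := fpsX (fps rat).
Definition vary : fps2 := fpsC (fpsX rat).

Definition F : fps2 := Fps (fun n => Fps (fun k => (J n k)%:R)).

(* The division by 1 - y (F - 1) is therefore never by a non-unit, where _^-1
   takes a default value. *)
Lemma denominator_unit (G : fps2) : 1 - vary * (G - 1) \is a GRing.unit.
Proof.
rewrite fps_unitE /= big_ord1 fps_unitE /= big_ord1 /= mul0r subr0.
exact: unitr1.
Qed.

(* Main.v *)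
Require Import Defs.
From HB Require Import structures.
From mathcomp Require Import all_boot all_order all_algebra.
From mathcomp Require Import ring zify.
Set Implicit Arguments.
Unset Strict Implicit.
Unset Printing Implicit Defensive.
Import Order.TTheory GRing.Theory Num.Theory.
Local Open Scope ring_scope.

(** An independent set of the core is a chain of pairs for the componentwise
order. Let C(i, j) be the size generating polynomial of the chains contained in
the box {a <= i, b <= j}. A chain of the box avoiding its corner (i, j) avoids
the last row or the last column, so for 1 <= i <= j inclusion-exclusion gives
  C(i, j) = (1 + y) (C(i-1, j) + C(i, j-1) - C(i-1, j-1)),
with C(i, i-1) = C(i-1, i-1) below the diagonal. Hence the series
e_d = \sum_i C(i, i+d) x^i - 1 satisfy a linear recurrence with a unique
solution. This solution is written in two ways. First, e_d = G B^d where
G (1 - y G) = x (1 + y) (1 + G) and B = (1 + y) / (1 - y G): as F = 1 + e_0 = 1 + G,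
this is the functional equation. Second, as predicted by Lagrange inversion for
G = x phi(G), phi(u) = (1 + y) (1 + u) / (1 - y u),
  [x^n] e_d = [u^(n-1)] ((1 + y) / (1 - y u))^d phi^(n-1) (phi - u phi'),
which for d = 0 is [u^(n-1)] phi^n / n. *)

(** * Coefficients of formal power series and the Euler derivation *)

Section FpsCoefs.
Variable R : comNzRingType.
Implicit Types f g : fps R.

Lemma coefsD f g n : coefs (f + g) n = coefs f n + coefs g n.
Proof. by []. Qed.

Lemma coefsN f n : coefs (- f) n = - coefs f n.
Proof. by []. Qed.

Lemma coefsMn f m n : coefs (f *+ m) n = coefs f n *+ m.
Proof. by elim: m => // m IHm; rewrite !mulrS coefsD IHm. Qed.

Lemma coefs_sum (I : Type) (r : seq I) (P : pred I) (E : I -> fps R) n :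
  coefs (\sum_(i <- r | P i) E i) n = \sum_(i <- r | P i) coefs (E i) n.
Proof.
by apply: (big_morph (fun f : fps R => coefs f n)) => [f g|]; rewrite ?coefsD.
Qed.

Lemma coefsCM a f n : coefs (fpsC a * f) n = a * coefs f n.
Proof.
rewrite coefsM big_ord_recl /= subn0 big1 ?addr0 // => i _.
by rewrite mul0r.
Qed.

Lemma coefsXM f n : coefs (fpsX R * f) n = if n is m.+1 then coefs f m else 0.
Proof.
rewrite coefsM; case: n => [|n]; first by rewrite big_ord1 /= mul0r.
rewrite big_ord_recl /= mul0r add0r big_ord_recl /= mul1r subn1 big1 ?addr0 //.
by move=> i _; rewrite mul0r.
Qed.

Lemma fpsC1 : fpsC 1 = 1 :> fps R.
Proof. by []. Qed.

Lemma fpsCD a b : fpsC (a + b) = fpsC a + fpsC b :> fps R.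
Proof. by apply: fpsP => -[|n] //=; rewrite addr0. Qed.

Lemma fpsCM a b : fpsC (a * b) = fpsC a * fpsC b :> fps R.
Proof. by apply: fpsP => n; rewrite coefsCM /=; case: eqP; rewrite ?mulr0. Qed.

Lemma fpsCX a m : fpsC (a ^+ m) = fpsC a ^+ m :> fps R.
Proof. by elim: m => // m IHm; rewrite !exprS fpsCM IHm. Qed.

Lemma coefsXnM f m n :
  coefs (fpsX R ^+ m * f) n = if (m <= n)%N then coefs f (n - m) else 0.
Proof.
elim: m n => [|m IHm] n; first by rewrite mul1r subn0.
by rewrite exprS -mulrA coefsXM; case: n => // n; rewrite IHm ltnS subSS.
Qed.

Lemma coefsXn m n : coefs (fpsX R ^+ m) n = (n == m)%:R.
Proof.
rewrite -[_ ^+ m]mulr1 coefsXnM coefs1 subn_eq0.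
by rewrite [n == m]eqn_leq andbC; case: leqP.
Qed.

Lemma coefs_1DXn m n : coefs ((1 + fpsX R) ^+ m) n = 'C(m, n)%:R.
Proof.
elim: m n => [|m IHm] n; first by rewrite coefs1 bin0n.
rewrite exprS mulrDl mul1r coefsD coefsXM IHm.
by case: n => [|n]; rewrite ?bin0 ?addr0 // IHm binS natrD.
Qed.

(* The derivation x d/dx. *)
Definition fps_euler f : fps R := Fps (fun n => coefs f n *+ n).

Lemma coefs_euler f n : coefs (fps_euler f) n = coefs f n *+ n.
Proof. by []. Qed.

Lemma fps_eulerM f g : fps_euler (f * g) = fps_euler f * g + f * fps_euler g.
Proof.
apply: fpsP => n; rewrite coefsD !coefsM coefs_euler coefsM -sumrMnl -big_split.
apply: eq_bigr => i _ /=; rewrite mulrnAl mulrnAr -mulrnDr subnKC //.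
by rewrite -ltnS.
Qed.

Lemma fps_eulerX f m : fps_euler (f ^+ m.+1) = f ^+ m * fps_euler f *+ m.+1.
Proof.
elim: m => [|m IHm]; first by rewrite mul1r.
by rewrite exprS fps_eulerM IHm !mulrS exprS -mulrnAr mulrA; ring.
Qed.

End FpsCoefs.

(** * Chains in boxes and their recurrence *)

Section ChainCount.
Variables (R : comNzRingType) (y : R) (N : nat).
Local Notation V := (core_vertex N).
Implicit Types (S : {set V}) (i j : nat).

Definition in_box i j : {set V} :=
  [set v : V | ((val v).1 <= i) && ((val v).2 <= j)]%N.

Definition chain_poly i j : R :=
  \sum_(S : {set V} | independent (@core_adj N) S && (S \subset in_box i j))
    y ^+ #|S|.

Lemma independentP S :
  reflect {in S &, forall u v, ~~ core_adj u v} (independent (@core_adj N) S).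
Proof.
apply: (iffP forall_inP) => [H u v uS vS | H u uS].
  by move/forall_inP: (H u uS); apply.
by apply/forall_inP => v; apply: H.
Qed.

Lemma chain_poly0 j : chain_poly 0 j = 1.
Proof.
rewrite /chain_poly (big_pred1 set0) => [|S]; first by rewrite cards0.
rewrite /pred1 /=; apply/andP/eqP => [[_ /subsetP sS] | ->]; last first.
  by split; [apply/independentP => u; rewrite inE | apply: sub0set].
apply/setP => v; rewrite inE; apply/negP => /sS; rewrite inE => /andP[v0 _].
by have /andP[] := valP v; rewrite lt0n -leqn0 v0.
Qed.

(** A vertex (a, b) has a <= b, so b <= i already forces a <= i. *)
Lemma chain_poly_below i : chain_poly i.+1 i = chain_poly i i.
Proof.
rewrite /chain_poly; suff -> : in_box i.+1 i = in_box i i by [].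
by apply/setP => -[[[a ?] [b ?]] /= ?]; rewrite !inE /=; lia.
Qed.

Lemma chain_poly_rec i j : (i <= j)%N -> (j < N)%N ->
  chain_poly i.+1 j.+1 =
  (1 + y) * (chain_poly i j.+1 + chain_poly i.+1 j - chain_poly i j).
Proof.
move=> le_ij lt_jN.
have ltiN : (i.+1 < N.+1)%N by lia.
have ltjN : (j.+1 < N.+1)%N by lia.
have Pv : (1 <= (Ordinal ltiN, Ordinal ltjN).1 <= (Ordinal ltiN, Ordinal ltjN).2)%N
  by rewrite /=.
pose v : V := exist (fun p : 'I_N.+1 * 'I_N.+1 => 1 <= p.1 <= p.2)%N _ Pv.
have vbox : v \in in_box i.+1 j.+1 by rewrite inE /= !leqnn.
(* The corner dominates the box in both coordinates, so no vertex of the box is adjacent to it: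
   inserting or removing it preserves independence, whence the factor 1 + y. *)
have vmax u : u \in in_box i.+1 j.+1 -> ~~ core_adj u v /\ ~~ core_adj v u.
  rewrite (core_adj_sym v) inE; case: u => [[a b] ab] /=.
  by rewrite /core_adj /=; lia.
pose ind S := independent (@core_adj N) S.
pose A := \sum_(S | [&& ind S, S \subset in_box i.+1 j.+1 & v \notin S]) y ^+ #|S|.
have -> : chain_poly i.+1 j.+1 = (1 + y) * A.
  rewrite /chain_poly (bigID (fun S => v \in S)) /= addrC mulrDl mul1r.
  congr (_ + _); first by apply: eq_bigl => S; rewrite -andbA.
  rewrite (reindex_onto (fun S => v |: S) (fun S => S :\ v)) /=; last first.
    by move=> S /andP[_ vS]; rewrite setD1K.
  rewrite /A mulr_sumr; apply: eq_big => [S | S].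
    rewrite setU11 andbT subUset sub1set vbox /=.
    case: (boolP (v \in S)) => [vS | vS].
      rewrite !andbF; apply/negP => /andP[_ /eqP eqS].
      by move: vS; rewrite -eqS !inE eqxx.
    rewrite setU1K // eqxx !andbT.
    case: (boolP (S \subset _)) => sS; rewrite ?andbF ?andbT //.
    apply/independentP/independentP => indS u w.
      by move=> uS wS; apply: indS; rewrite inE ?uS ?wS orbT.
    rewrite !inE => /predU1P[->|uS] /predU1P[->|wS].
    - by rewrite core_adj_irr.
    - by case: (vmax w (subsetP sS _ wS)).
    - by case: (vmax u (subsetP sS _ uS)).
    - exact: indS.
  move=> /andP[_ /eqP eqS]; have vS : v \notin S by rewrite -eqS !inE eqxx.
  by rewrite cardsU1 vS exprS.
congr (_ * _).
(* Without subtraction, inclusion-exclusion can be checked set by set, as [P or Q] + [P and Q] = [P]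
   + [Q]. *)
apply: (addIr (chain_poly i j)); rewrite subrK.
rewrite /A /chain_poly.
rewrite [X in X + _]big_mkcondr [X in _ + X]big_mkcondr -big_split.
rewrite [X in _ = X + _]big_mkcondr [X in _ = _ + X]big_mkcondr -big_split.
apply: eq_bigr => S /independentP indS /=.
have -> : in_box i j = in_box i j.+1 :&: in_box i.+1 j.
  by apply/setP => u; rewrite !inE; lia.
rewrite subsetI.
(* If S met both the last row, in (i+1, b), and the last column, in (a, j+1),
   without containing the corner, these two vertices would be adjacent. *)
have -> : (S \subset in_box i.+1 j.+1) && (v \notin S) =
    (S \subset in_box i j.+1) || (S \subset in_box i.+1 j).
  apply/andP/orP => [[/subsetP sS vS] | sS].
    case: (boolP (S \subset in_box i j.+1)) => [_|]; first by left.
    case/subsetPn => u uS uN; right; apply/subsetP => w wS.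
    have := indS u w uS wS; have := sS u uS; have := sS w wS.
    have {uN} := uN; rewrite !inE => uN wB uB uw.
    have : w != v by apply: contraNneq vS => <-.
    have : u != v by apply: contraNneq vS => <-.
    rewrite -!val_eqE /= -!pair_eqE /= -!val_eqE /=.
    move: uN uB wB uw; rewrite /core_adj.
    case: u {uS} => [[[a ?] [b ?]] ?]; case: w {wS} => [[[c ?] [d ?]] ?] /=.
    lia.
  split; last first.
    apply/negP => vS; case: sS => /subsetP/(_ v vS); rewrite inE /=; lia.
  case: sS => /subset_trans; apply; apply/subsetP => u; rewrite !inE; lia.
by do 2!case: (S \subset _); rewrite ?addr0 ?add0r.
Qed.

End ChainCount.

Lemma coefs_chain_poly n k :
  coefs (chain_poly (fpsX rat) n n n) k = (J n k)%:R.
Proof.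
rewrite /chain_poly coefs_sum /J -sum1_card natr_sum.
rewrite big_mkcond [RHS]big_mkcond; apply: eq_bigr => S _.
have -> : S \subset in_box n n n.
  by apply/subsetP => -[[a b] ?] _; rewrite inE /= -ltnS ltn_ord -ltnS ltn_ord.
rewrite inE andbT coefsXn eq_sym.
by case: (independent _ _); case: (_ == _).
Qed.

(** For positive d the boundary values C(0, j) = 1 of the two shifted terms cancel. For d = 0,
    [chain_poly_below] leaves the single term (1 + y) C(i-1, i), and the boundary value stays. *)
Definition solves_chain_rec (R : comNzRingType) (y : R) (e : nat -> fps R) :=
  e 0%N = fpsX R * fpsC (1 + y) * (1 + e 1%N) /\
  forall d, e d.+1 = fpsC (1 + y) * (fpsX R * e d.+2 + e d - fpsX R * e d.+1).

(** Uniqueness: the value at (i+1, d+1) is determined by those at (i, d+2), (i+1, d) and (i, d+1),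
    so an induction on i, then on d, suffices. *)
Lemma chain_poly_solution (R : comNzRingType) (y : R) N e :
  solves_chain_rec y e -> forall i d, (i + d <= N)%N ->
  chain_poly y N i (i + d) = coefs (1 + e d) i.
Proof.
move=> [e0 eS].
elim=> [d _|i IHi].
  rewrite chain_poly0 coefsD coefs1 /=.
  suff -> : coefs (e d) 0 = 0 by rewrite addr0.
  elim: d => [|d IHd]; first by rewrite e0 -mulrA coefsXM.
  by rewrite eS coefsCM !coefsD coefsN !coefsXM IHd; ring.
elim=> [|d IHd] le_N.
  rewrite addn0 in le_N *.
  rewrite chain_poly_rec // chain_poly_below addrK.
  have := IHi 1%N; rewrite addn1 => -> //.
  by rewrite [RHS]coefsD coefs1 /= add0r [in RHS]e0 -mulrA coefsXM coefsCM.
rewrite addnS addSn chain_poly_rec; [|lia|lia].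
rewrite (_ : (i + d).+2 = i + d.+2)%N; last by lia.
rewrite (_ : (i + d).+1 = i.+1 + d)%N; last by lia.
rewrite IHi; last by lia.
rewrite IHd; last by lia.
rewrite (_ : i.+1 + d = i + d.+1)%N; last by lia.
rewrite IHi; last by lia.
rewrite !coefsD !coefs1 [in RHS]eS coefsCM !coefsD coefsN !coefsXM /=.
by move: (_%:R) => z; ring.
Qed.

(** * The algebraic solution of the recurrence *)

Section AlgebraicSolution.
Variables (R : comNzRingType) (y : R).
Local Notation X := (fpsX R).
Local Notation Y := (fpsC y).
Implicit Types g : fps R.

Definition core_step g : fps R := Y * g ^+ 2 + X * (1 + Y) * (1 + g).

Lemma coefs_core_step0 g : coefs g 0 = 0 -> coefs (core_step g) 0 = 0.
Proof.
by move=> g0; rewrite coefsD coefsCM -mulrA coefsXM coefsM big_ord1 /= g0; ring.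
Qed.

(** [core_step] is an x-adic contraction: its affine part carries a factor x, and with zero constant
    terms the coefficient of index n of a square only involves indices below n. *)
Lemma core_step_agree g1 g2 m :
  coefs g1 0 = 0 -> coefs g2 0 = 0 ->
  (forall n, (n <= m)%N -> coefs g1 n = coefs g2 n) ->
  forall n, (n <= m.+1)%N -> coefs (core_step g1) n = coefs (core_step g2) n.
Proof.
move=> g10 g20 eqg n le_nm; rewrite !coefsD !coefsCM -!mulrA !coefsXM.
congr (_ * _ + _); last first.
  case: n le_nm => // n; rewrite ltnS => le_nm.
  by rewrite -fpsC1 -fpsCD !coefsCM !coefsD eqg.
rewrite !coefsM; apply: eq_bigr => -[i /=]; rewrite ltnS => le_in _.
case: (posnP i) => [-> | i_gt0]; first by rewrite g10 g20 !mul0r.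
case: (posnP (n - i)) => [-> | ni_gt0]; first by rewrite g10 g20 !mulr0.
by rewrite !eqg //; lia.
Qed.

Lemma core_step_fixpoint : exists g, core_step g = g.
Proof.
pose it k := iter k core_step 0.
have it0 k : coefs (it k) 0 = 0.
  by elim: k => // k IHk; apply: coefs_core_step0.
have itS k n : (n <= k)%N -> coefs (it k.+1) n = coefs (it k) n.
  elim: k n => [|k IHk] n; first by rewrite leqn0 => /eqP ->; rewrite !it0.
  exact: core_step_agree (it0 _) (it0 _) IHk n.
(* The x-adic limit of the iterates: coefficient n is stable from the n-th one on. *)
pose g : fps R := Fps (fun n => coefs (it n) n).
have gE k n : (n <= k)%N -> coefs g n = coefs (it k) n.
  elim: k => [|k IHk]; first by rewrite leqn0 => /eqP ->.
  rewrite leq_eqVlt => /predU1P[-> //|]; rewrite ltnS => le_nk.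
  by rewrite itS // IHk.
have g0 : coefs g 0 = 0 by [].
exists g; apply: fpsP => n.
by rewrite (core_step_agree g0 (it0 n) (gE n)) // (itS n n) //.
Qed.

Lemma algebraic_solution g b :
  core_step g = g -> b * (1 - Y * g) = 1 ->
  solves_chain_rec y (fun d => g * ((1 + Y) * b) ^+ d).
Proof.
move=> gE b1.
have bE : b = 1 + b * Y * g by rewrite -{1}b1; ring.
have gbE : g = b * X * (1 + Y) * (1 + g).
  transitivity (b * (core_step g - Y * g ^+ 2)); last by rewrite /core_step; ring.
  by rewrite gE -{1}[g]mul1r -b1; ring.
split=> [|d]; rewrite fpsCD fpsC1.
  have -> : 1 + g * ((1 + Y) * b) ^+ 1 = b * (1 + g).
    by rewrite -{1}b1; ring.
  by rewrite expr0 mulr1 {1}gbE; ring.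
(* With B = (1 + Y) b, this is the recurrence stripped of the common factor (1 + Y) g B^d. *)
suff bbE : b = X * ((1 + Y) * b) ^+ 2 + 1 - X * ((1 + Y) * b).
  by rewrite !exprS {1}bbE; ring.
have B1 : (1 + Y) * b - 1 = b * Y * (1 + g).
  by rewrite -[Z in _ - Z]b1; ring.
transitivity (1 + X * ((1 + Y) * b) * ((1 + Y) * b - 1)); last by ring.
by rewrite B1 {1}bE {1}gbE; ring.
Qed.
End AlgebraicSolution.

(** * The solution in Lagrange form *)

Section LagrangeSolution.
Variables (R : comNzRingType) (y : R) (b : fps R).
Local Notation X := (fpsX R).
Local Notation Y := (fpsC y).
Hypothesis b1 : b * (1 - Y * X) = 1.

Let B := (1 + Y) * b.
Let phi := (1 + Y) * (1 + X) * b.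
Let W := phi - fps_euler phi.

Lemma geometricE : b = 1 + X * (Y * b).
Proof. by rewrite -{1}b1; ring. Qed.

(** The negative binomial expansion; the relation [bX] between consecutive powers is Pascal's rule
    on coefficients. *)
Lemma coefs_geometricX m j : coefs (b ^+ m.+1) j = y ^+ j *+ 'C(m + j, m).
Proof.
elim: m j => [|m IHm].
  elim=> [|j IHj]; rewrite geometricE coefsD coefs1 coefsXM ?addr0 //.
  by rewrite coefsCM -[b]expr1 IHj add0n !bin0 add0r exprS.
have bX : b ^+ m.+2 = b ^+ m.+1 + X * (Y * b ^+ m.+2).
  by rewrite (exprS b m.+1) {1}geometricE; move: (b ^+ _) => z; ring.
elim=> [|j IHj]; rewrite bX coefsD coefsXM IHm.
  by rewrite !addn0 !binn addr0.
by rewrite coefsCM IHj mulrnAr -exprS -mulrnDr addnS addSn binS addnC addnS.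
Qed.

Lemma lagrange_BE : B = (1 + Y) + X * (Y * B).
Proof. by rewrite /B {1}geometricE; ring. Qed.

Lemma lagrange_phiE : phi = (1 + Y) + X * ((1 + Y) * B).
Proof.
transitivity ((1 + Y) * (b + X * b)); first by rewrite /phi; ring.
by rewrite {1}geometricE /B; ring.
Qed.

(** Formally, with x = X / phi, this reads B = (1 + y) (1 + x B^2 - x B), the characteristic
    equation of the recurrence in d. *)
Lemma lagrange_phiBE : phi * B = (1 + Y) * phi + X * ((1 + Y) * B * (B - 1)).
Proof.
have BE : B - 1 = Y * (1 + X) * b.
  by rewrite /B mulrDl mul1r {1}geometricE; ring.
by rewrite BE {1}lagrange_BE /phi /B; ring.
Qed.

(** Since (m+1) phi^m u phi' is the Euler derivative of phi^(m+1), the coefficient of u^n in (m+1)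
    phi^m W is m+1-n times that of phi^(m+1). Here n = m. *)
Lemma coefs_expr_lagrange m :
  coefs (phi ^+ m * W) m *+ m.+1 = coefs (phi ^+ m.+1) m.
Proof.
rewrite /W mulrBr -exprSr -coefsMn mulrnBl -fps_eulerX coefsD coefsN.
by rewrite coefsMn coefs_euler mulrSr; ring.
Qed.

Hypothesis torsion_free : forall (a : R) n, a *+ n.+1 = 0 -> a = 0.

(** The same computation at n = m+1, where the factor m+1-n vanishes. *)
Lemma coefs_expr_lagrange0 m : coefs (phi ^+ m * W) m.+1 = 0.
Proof.
apply: (@torsion_free _ m); rewrite /W mulrBr -exprSr -coefsMn mulrnBl.
by rewrite -fps_eulerX coefsD coefsN coefsMn coefs_euler subrr.
Qed.

(* The coefficient of x^m is that of u^m in B^d phi^m W: a diagonal extraction,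
   in which the variable X of [B], [phi] and [W] stands for u. *)
Definition lagrange_series d : fps R :=
  Fps (fun m => coefs (B ^+ d * phi ^+ m * W) m).

Lemma coefs_lagrange_series d m :
  coefs (lagrange_series d) m = coefs (B ^+ d * phi ^+ m * W) m.
Proof. by []. Qed.

Lemma lagrange_series0 :
  lagrange_series 0 = (1 + Y) * (1 + X * lagrange_series 1).
Proof.
rewrite -fpsC1 -fpsCD; apply: fpsP => -[|m];
  rewrite coefsCM coefsD coefs1 coefsXM !coefs_lagrange_series.
  rewrite !mul1r /W coefsD coefsN coefs_euler mulr0n subr0 addr0 lagrange_phiE.
  by rewrite -fpsC1 -fpsCD coefsD coefsXM addr0 mulr1.
(* One factor phi is expanded. At index m+1 the first summand vanishes by [coefs_expr_lagrange0],
   and X shifts the second to index m, on the diagonal again. *)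
have -> : B ^+ 0 * phi ^+ m.+1 * W =
    fpsC (1 + y) * (phi ^+ m * W + X * (B ^+ 1 * phi ^+ m * W)).
  rewrite fpsCD exprS {1}lagrange_phiE fpsC1.
  by move: (phi ^+ _) W => z w; ring.
by rewrite coefsCM coefsD coefs_expr_lagrange0 coefsXM.
Qed.

Lemma lagrange_seriesS d :
  lagrange_series d.+1 = (1 + Y) * (X * lagrange_series d.+2 +
    lagrange_series d - X * lagrange_series d.+1).
Proof.
rewrite -fpsC1 -fpsCD; apply: fpsP => -[|m];
  rewrite coefsCM !coefsD coefsN !coefsXM !coefs_lagrange_series.
  rewrite oppr0 addr0 add0r !mulr1 exprS {1}lagrange_BE.
  have -> : (1 + Y + X * (Y * B)) * B ^+ d * W =
     fpsC (1 + y) * (B ^+ d * W) + X * (Y * B * B ^+ d * W).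
    by rewrite fpsCD fpsC1; ring.
  by rewrite coefsD coefsCM coefsXM addr0.
have -> : B ^+ d.+1 * phi ^+ m.+1 * W =
    fpsC (1 + y) * (B ^+ d * phi ^+ m.+1 * W +
      X * (B ^+ d.+2 * phi ^+ m * W - B ^+ d.+1 * phi ^+ m * W)).
  transitivity (phi * B * (B ^+ d * phi ^+ m * W)).
    by rewrite !exprS; ring.
  by rewrite lagrange_phiBE fpsCD fpsC1 !exprS; ring.
by rewrite coefsCM coefsD coefsXM coefsD coefsN; ring.
Qed.

Lemma lagrange_solution : solves_chain_rec y (fun d => X * lagrange_series d).
Proof.
split=> [|d]; rewrite fpsCD fpsC1; first by rewrite {1}lagrange_series0; ring.
by rewrite {1}lagrange_seriesS; ring.
Qed.

Lemma coefs_lagrange_solution m :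
  coefs (X * lagrange_series 0) m.+1 *+ m.+1 =
  (1 + y) ^+ m.+1 * \sum_(0 <= j < m.+1) y ^+ j *+ ('C(m.+1, j.+1) * 'C(m + j, m)).
Proof.
rewrite coefsXM coefs_lagrange_series mul1r coefs_expr_lagrange /phi -mulrA !exprMn.
rewrite -fpsC1 -fpsCD -fpsCX coefsCM; congr (_ * _).
(* Reversal makes j the exponent taken from the geometric factor; (1 + X)^(m+1) then contributes
   C(m+1, m-j) = C(m+1, j+1). *)
rewrite coefsM big_mkord (reindex_inj rev_ord_inj); apply: eq_bigr => -[j /= lt_jm] _.
rewrite subSS coefs_1DXn coefs_geometricX mulr_natl -mulrnA mulnC.
by rewrite subKn // -(@bin_sub _ j.+1) // subSS.
Qed.

End LagrangeSolution.

(** * Both solutions identified with F - 1 *)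

Lemma F_solution e : solves_chain_rec (fpsX rat) e -> F = 1 + e 0%N.
Proof.
move=> eP; apply: fpsP => n.
have := chain_poly_solution eP (i := n) (d := 0) (N := n).
by rewrite addn0 leqnn => <- //; apply: fpsP => k; rewrite coefs_chain_poly.
Qed.

Theorem mainTheorem6 :
  F = 1 + varx * F + varx * vary * F ^+ 2 / (1 - vary * (F - 1)) /\
  forall n k : nat, (1 <= n)%N ->
    (J n k)%:R = 1 / n%:R *
      \sum_(0 <= j < n)
        (binz n (k%:Z - j%:Z) * 'C(n, j.+1) * 'C(n.-1 + j, n.-1))%:R :> rat.
Proof.
split.
  have [g gE] := core_step_fixpoint (fpsX rat).
  have UD : (1 - vary * g : fps2) \is a GRing.unit.
    by rewrite -{1}[g](addKr 1) (addrC (-1)) denominator_unit.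
  have b1 := mulVr UD.
  have FE : F = 1 + g.
    by rewrite (F_solution (algebraic_solution gE b1)) expr0 mulr1.
  rewrite FE -(addrC (-1)) addKr.
  move: (_^-1) b1 => b b1; rewrite -addrA; congr (_ + _).
  (* This gives g = b x (1 + y) (1 + g); the claim then follows from b (1 + y) = 1 + b y (1 + g). *)
  transitivity (b * (core_step (fpsX rat) g - vary * g ^+ 2)).
    by rewrite gE -{1}[g]mul1r -b1; ring.
  rewrite -[varx * (1 + g)]mul1r -{1}b1 /core_step -/varx -/vary.
  by ring.
move=> [//|m] k _.
(* Here [varx] plays the role of the auxiliary variable u. *)
have Ub : (1 - vary * varx : fps2) \is a GRing.unit.
  by rewrite -[varx](addKr 1) (addrC (-1)) denominator_unit.
have b1 := mulVr Ub.
have tf (a : fps rat) n : a *+ n.+1 = 0 -> a = 0.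
  move=> an0; apply: fpsP => i; apply/eqP.
  have /(congr1 (fun f => coefs f i))/eqP := an0.
  by rewrite coefsMn mulrn_eq0.
have FE := F_solution (lagrange_solution b1 tf).
have := coefs_lagrange_solution b1 m.
set e := (X in coefs X) => eE.
have eF : coefs e m.+1 = coefs F m.+1 by rewrite FE coefsD coefs1 add0r.
move: eE; rewrite eF => /(congr1 (fun f => coefs f k)).
have -> : coefs (coefs F m.+1 *+ m.+1) k = (J m.+1 k)%:R *+ m.+1.
  by rewrite coefsMn.
rewrite -mulr_natl => JE.
apply: (mulfI (x := m.+1%:R)); first by rewrite pnatr_eq0.
rewrite JE mulrA mul1r divff ?pnatr_eq0 // mul1r.
rewrite mulr_sumr coefs_sum; apply: eq_bigr => j _.
rewrite mulrnAr coefsMn mulrC coefsXnM coefs_1DXn -mulnA natrM mulr_natr.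
congr (_ *+ _); rewrite /binz.
(* For k < j the shift by y^j gives coefficient 0, which matches [binz] at a negative integer. *)
case: leqP => [le_jk | lt_kj]; first by rewrite subzn.
by case E: (_ - _) => [z|z] //; lia.
Qed.
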